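(* Let $\mathcal{F}$ be a linear subspace of a complex separable Hilbert space $\mathcal{H}$. Let $C$ be a conjugation on $\mathcal{H}$ and let $T$ be a $C$-symmetric operator in $\mathcal{H}$ such that $C\mathcal{F}\subseteq\mathcal{D}(\overline{T})$. Assume that $\mathcal{F}$ is a core for $T^*$. Then $\overline{T}$ is $C$-selfadjoint.
   Context: Operators may be unbounded; $\mathcal{D}(T)$ is the domain and $\overline{T}$ the closure of $T$. A conjugation on $\mathcal{H}$ is an antilinear map $C:\mathcal{H}\to\mathcal{H}$ with $C^2=I$ and $\langle Cf,Cg\rangle=\langle g,f\rangle$ for all $f,g\in\mathcal{H}$. A densely defined operator $T$ in $\mathcal{H}$ is $C$-symmetric if $T\subseteq CT^*C$ and $C$-selfadjoint if $T=CT^*C$. A $C$-symmetric operator is closable. A linear subspace $\mathcal{F}\subseteq\mathcal{D}(A)$ is a core for a closable operator $A$ if $\overline{A|_{\mathcal{F}}}=\overline{A}$. *)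

(* Defs.v *)
From mathcomp Require Import all_boot all_order all_algebra.
From mathcomp Require Export complex.
From mathcomp Require Import all_classical all_reals all_analysis.
Import numFieldNormedType.Exports.
Set Implicit Arguments.
Unset Strict Implicit.
Unset Printing Implicit Defensive.
Import Order.TTheory GRing.Theory Num.Theory.
Local Open Scope classical_set_scope.
Local Open Scope ring_scope.
Local Open Scope complex_scope.

(* An inner product inducing the given norm, linear in its first argument and
   conjugate-linear in its second.  A complex Hilbert space is a
   [completeNormedModType R[i]] equipped with an [inner_product]. *)
Record inner_product (R : realType) (H : normedModType R[i]) := InnerProduct {
  ip_form :> {dot H for Num.conj};
  ip_norm : forall f : H, ip_form f f = `|f| ^+ 2
}.

Definition separable (X : topologicalType) :=
  exists2 D : set X, countable D & dense D.

Section Operators.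
Variables (R : realType) (H : completeNormedModType R[i]).
Variable ip : inner_product H.

Definition linear_subspace (V : lmodType R[i]) (F : set V) :=
  submod_closed (mem F).

(* Unbounded operators are identified with their graphs: [T (f, h)] says that
   f is in the domain of T and T f = h.  Inclusion of sets is then inclusion of
   operators, and equality of sets is equality of operators (same domain, same
   values). *)
Definition is_operator (T : set (H * H)) :=
  linear_subspace T /\ forall f h k, T (f, h) -> T (f, k) -> h = k.

Definition dom (T : set (H * H)) : set H := [set f | exists h, T (f, h)].

Definition densely_defined (T : set (H * H)) := dense (dom T).

(* The adjoint T^* as a graph; it is the graph of an operator when T is densely
   defined. *)
Definition adjoint (T : set (H * H)) : set (H * H) :=
  [set p | forall f h, T (f, h) -> ip h p.1 = ip f p.2].

(* An operator T is closable when the closure of its graph in H * H is the graph of an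
   operator; the latter is then the closure of T, written [closure T]. *)
Definition closable (T : set (H * H)) :=
  is_operator T /\ is_operator (closure T).

Definition op_restrict (T : set (H * H)) (F : set H) : set (H * H) :=
  [set p | T p /\ F p.1].

Definition is_core (F : set H) (A : set (H * H)) :=
  [/\ closable A, linear_subspace F, F `<=` dom A &
      closure (op_restrict A F) = closure A].

Definition is_conjugation (C : H -> H) :=
  [/\ linear_for (Num.conj \; *:%R) C,
      forall f, C (C f) = f &
      forall f g, ip (C f) (C g) = ip g f].

(* The operator C S C, with domain {f | C f \in dom S}. *)
Definition conjugate_op (C : H -> H) (S : set (H * H)) : set (H * H) :=
  [set p | exists2 h, S (C p.1, h) & p.2 = C h].

Definition C_symmetric (C : H -> H) (T : set (H * H)) :=
  [/\ is_operator T, densely_defined T & T `<=` conjugate_op C (adjoint T)].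

Definition C_selfadjoint (C : H -> H) (T : set (H * H)) :=
  [/\ is_operator T, densely_defined T & T = conjugate_op C (adjoint T)].

End Operators.

(* Main.v *)
(** [T^*] is closed and [T ⊆ C T^* C], so [closure T ⊆ C T^* C], and
    [(closure T)^* = T^*].  For [g] in the core [F], the vector [C g] lies in
    the domain of [closure T], and the first inclusion then forces
    [closure T (C g) = C T^* g].  Hence the image of the graph of [T^*|_F] under
    the homeomorphism [C × C] is contained in the graph of [closure T]; taking
    closures gives [C T^* C ⊆ closure T]. *)
Require Import Defs.
From mathcomp Require Import all_boot all_order all_algebra.
From mathcomp Require Import complex.
From mathcomp Require Import all_classical all_reals all_analysis.
From mathcomp Require Import ring.
Import numFieldNormedType.Exports.
Set Implicit Arguments.
Unset Strict Implicit.
Unset Printing Implicit Defensive.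
Import Order.TTheory GRing.Theory Num.Theory.
Local Open Scope classical_set_scope.
Local Open Scope ring_scope.
Local Open Scope complex_scope.

Lemma closed_equalizer (X : topologicalType) (K : numFieldType)
    (f g : X -> K) :
  continuous f -> continuous g -> closed [set x | f x = g x].
Proof.
move=> cf cg.
have -> : [set x | f x = g x] = (fun x => f x - g x) @^-1` [set 0].
  by apply/seteqP; split=> x /= => [->|/eqP];
    rewrite ?subrr// subr_eq0 => /eqP.
apply: preimage_closed => [x _|].
  by apply: cvgB; [exact: cf|exact: cg].
by apply: accessible_closed_set1; apply: hausdorff_accessible;
  exact: norm_hausdorff.
Qed.

Lemma closure_stable (X : topologicalType) (f : X -> X) (A : set X) :
  continuous f -> (forall x, A x -> closure A (f x)) ->
  forall x, closure A x -> closure A (f x).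
Proof.
move=> cf Af x Ax.
have cl : closed (f @^-1` closure A).
  by apply: preimage_closed => [y _|]; [exact: cf|exact: closed_closure].
by apply: cl; apply: (closureS _ Ax) => y; exact: Af.
Qed.

(** One variable is moved to the closure at a time: first [u] with the other vector fixed in [A],
    then [v] with [u] fixed in the closure. *)
Lemma linear_subspace_closure (R : realType) (V : normedModType R[i])
    (A : set V) : linear_subspace A -> linear_subspace (closure A).
Proof.
move=> [A0 Alin]; split.
  by rewrite inE; apply: subset_closure; rewrite -inE.
move=> a u v; rewrite !inE => Au Av.
have translate w : A w -> closure A (a *: u + w).
  move=> Aw; apply: (@closure_stable _ (fun z => a *: z + w) A) Au => [z|z Az].
    by apply: cvgD; [apply: cvgZr; exact: cvg_id|exact: cvg_cst].
  by apply: subset_closure; rewrite -inE; apply: Alin; rewrite inE.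
apply: (@closure_stable _ (fun z => a *: u + z) A) Av => // z.
by apply: cvgD; [exact: cvg_cst|exact: cvg_id].
Qed.

(** Reduces the form to its diagonal values, which for an [inner_product] are squared norms; this is
    the route to continuity. *)
Lemma polarization (K : numClosedFieldType) (U : lmodType K)
    (form : {dot U for Num.conj}) (u v : U) :
  form u v = 4^-1 * (form (u + v) (u + v) - form (u - v) (u - v)
    + 'i%R * (form (u + 'i%R *: v) (u + 'i%R *: v)
            - form (u - 'i%R *: v) (u - 'i%R *: v))).
Proof.
rewrite !hnormB !hnormD /= !expr0 !mul1r !linearZr_LR /=.
rewrite !rmorphM /= conjCK conjCi.
have i2 := sqrCi K.
have n4 : 4 != 0 :> K by rewrite pnatr_eq0.
apply: (mulfI n4); rewrite mulrA mulfV// mul1r.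
(* The diagonal terms cancel with ['i] still treated as an indeterminate; only afterwards is
   ['i ^+ 2 = -1] used to cancel the conjugates. *)
transitivity (2 * (form u v + (form u v)^*) - 2 * 'i%R ^+ 2 * (form u v - (form u v)^*)); last by ring.
by rewrite i2; ring.
Qed.

Section InnerProduct.
Variables (R : realType) (H : completeNormedModType R[i]).
Variable ip : inner_product H.

(** By polarization, this is a combination of squared norms of translates of [u]. *)
Lemma form_continuousl (v : H) :
  continuous (fun u : H => (ip u v : (R[i] : numFieldType))).
Proof.
have norm2 (w : H) :
    continuous (fun u : H => `|u + w| ^+ 2 : (R[i] : numFieldType)).
  move=> u; rewrite /=; under eq_fun do rewrite expr2.
  have cuw : (fun u : H => `|u + w|) @ u --> `|u + w|.
    by apply: cvg_norm; apply: cvgD; [exact: cvg_id|exact: cvg_cst].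
  exact: cvgM.
have -> : (fun u => ip u v : (R[i] : numFieldType)) = (fun u =>
    4^-1 * (`|u + v| ^+ 2 - `|u - v| ^+ 2
      + 'i%R * (`|u + 'i%R *: v| ^+ 2 - `|u - 'i%R *: v| ^+ 2))).
  by apply/funext => u; rewrite polarization !ip_norm.
move=> u.
apply: cvgM; first exact: cvg_cst.
apply: cvgD; first by apply: cvgB; exact: norm2.
apply: cvgM; first exact: cvg_cst.
by apply: cvgB; exact: norm2.
Qed.

Lemma form_continuousl_comp (X : topologicalType) (g : X -> H) (v : H) :
  continuous g -> continuous (fun x : X => (ip (g x) v : (R[i] : numFieldType))).
Proof.
move=> cg x.
apply: (cvg_comp g (fun u : H => ip u v : (R[i] : numFieldType))).
  exact: cg.
exact: form_continuousl.
Qed.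

Lemma form_conj (u v : H) : ip u v = Num.conj (ip v u).
Proof. by rewrite hermC expr0 mul1r. Qed.

(** Moves the components of the pair into the first slot of the form, where continuity is
    established. *)
Lemma adjoint_form_conj (T : set (H * H)) (u v : H) :
  adjoint ip T (u, v) <-> (forall f h, T (f, h) -> ip u h = ip v f).
Proof.
split=> /= Tuv f h /Tuv e; first by rewrite form_conj e -form_conj.
by rewrite form_conj e -form_conj.
Qed.

(** Each [(f, h)] in [T] imposes one closed condition on [(u, v)], and the adjoint is the
    intersection of these. *)
Lemma closed_adjoint (T : set (H * H)) : closed (adjoint ip T).
Proof.
move=> [u v] Tuv; apply/adjoint_form_conj => f h Tfh.
have cl : closed [set p : H * H | ip p.1 h = ip p.2 f].
  by apply: closed_equalizer; apply: form_continuousl_comp => p;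
    [exact: cvg_fst|exact: cvg_snd].
by apply: (cl (u, v)); apply: (closureS _ Tuv) => -[x y]
  /adjoint_form_conj; exact.
Qed.

(** Conversely to the above, with [(u, v)] fixed the defining identity is a closed condition on
    [(f, h)], so it passes from [T] to its closure. *)
Lemma adjoint_closure (T : set (H * H)) :
  adjoint ip (closure T) = adjoint ip T.
Proof.
apply/seteqP; split=> -[u v] /= Tuv f h Tfh; first exact/Tuv/subset_closure.
have cl : closed [set p : H * H | ip p.2 u = ip p.1 v].
  by apply: closed_equalizer; apply: form_continuousl_comp => p;
    [exact: cvg_snd|exact: cvg_fst].
by apply: (cl (f, h)); apply: (closureS _ Tfh) => -[x y]; exact: Tuv.
Qed.

Section Conjugation.
Variable C : H -> H.
Hypothesis HC : is_conjugation ip C.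

Lemma conjugationK : involutive C.
Proof. by case: HC. Qed.

Lemma conjugationB (f g : H) : C (f - g) = C f - C g.
Proof.
have [Clin _ _] := HC.
by rewrite addrC -scaleN1r Clin /= rmorphN1 scaleN1r addrC.
Qed.

Lemma conjugation_norm (f : H) : `|C f| = `|f|.
Proof.
have [_ _ Cip] := HC.
by apply/eqP; rewrite -(@eqrXn2 _ 2)// -!(ip_norm ip) Cip.
Qed.

Lemma conjugation_continuous : continuous C.
Proof.
move=> f; apply/cvgrPdist_lt => e e0; near=> g.
rewrite -conjugationB conjugation_norm; near: g.
exact: cvgr_dist_lt.
Unshelve. all: by end_near. Qed.

(** Since [C] is an involution, the graph of [C S C] is the preimage of that of [S] under [C × C];
    closedness can then be pulled back. *)
Lemma conjugate_opE (S : set (H * H)) (f h : H) :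
  conjugate_op C S (f, h) <-> S (C f, C h).
Proof.
split=> [[k /= Sk ->]|Sfh]; first by rewrite conjugationK.
by exists (C h) => //=; rewrite conjugationK.
Qed.

Lemma conjugation_pair_continuous :
  continuous (fun p : H * H => (C p.1, C p.2)).
Proof.
move=> p; apply: cvg_pair.
  by apply: (@continuous_comp _ _ _ fst C);
    [exact: cvg_fst|exact: conjugation_continuous].
by apply: (@continuous_comp _ _ _ snd C);
    [exact: cvg_snd|exact: conjugation_continuous].
Qed.

Lemma closed_conjugate_op (S : set (H * H)) :
  closed S -> closed (conjugate_op C S).
Proof.
move=> cS.
have -> : conjugate_op C S = (fun p : H * H => (C p.1, C p.2)) @^-1` S.
  by apply/seteqP; split=> -[f h] /conjugate_opE.
by apply: preimage_closed => // p _; exact: conjugation_pair_continuous.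
Qed.

End Conjugation.
End InnerProduct.

Theorem proposition14 (R : realType) (H : completeNormedModType R[i])
    (ip : inner_product H) (Hsep : separable H)
    (F : set H) (HF : linear_subspace F)
    (C : H -> H) (HC : is_conjugation ip C)
    (T : set (H * H)) (HT : C_symmetric ip C T)
    (HCF : C @` F `<=` dom (closure T))
    (Hcore : is_core F (adjoint ip T)) :
  C_selfadjoint ip C (closure T).
Proof.
have [[Tlin _] Tdense TsubCT] := HT.
have [[[_ adjoint_fun] _] _ Fdom core] := Hcore.
have clTsub : closure T `<=` conjugate_op C (adjoint ip T).
  have cl := closed_conjugate_op HC (closed_adjoint (ip := ip) (T := T)).
  by move=> p /(closureS TsubCT); exact: cl.
split.
- split; first exact: linear_subspace_closure.
  (* The closure inherits single-valuedness from the adjoint, through the inclusion [clTsub] and the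
     injectivity of [C]. *)
  move=> f h k /clTsub/(conjugate_opE HC) Tfh /clTsub/(conjugate_opE HC) Tfk.
  by apply: (can_inj (conjugationK HC)); exact: adjoint_fun Tfh Tfk.
- move=> O O0 Oo; have [f [Of [h Tfh]]] := Tdense O O0 Oo.
  by exists f; split=> //; exists h; exact: subset_closure.
- rewrite adjoint_closure; apply/seteqP; split=> // -[f h].
  move=> /(conjugate_opE HC) Tfh.
  have CTF : op_restrict (adjoint ip T) F `<=`
      (fun p : H * H => (C p.1, C p.2)) @^-1` closure T.
    move=> [g n] /= [Tgn Fg].
    have [m Tm] : dom (closure T) (C g) by apply: HCF; exists g.
    (* Both [n] and [C m] are values of the adjoint at [g], so [n = C m] and [C n = m]. *)
    have /(conjugate_opE HC) := clTsub _ Tm; rewrite (conjugationK HC) => Tgm.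
    by rewrite (adjoint_fun _ _ _ Tgn Tgm) (conjugationK HC).
  (* The core hypothesis makes [(C f, C h)] a limit of pairs from the restriction to [F]; applying
     [C × C] once more returns [(f, h)]. *)
  have := subset_closure Tfh; rewrite -core => /(closureS CTF) cl.
  have /= := preimage_closed (fun p _ => conjugation_pair_continuous HC (x := p))
    (@closed_closure _ T) cl.
  by rewrite !(conjugationK HC).
Qed.
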